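(* Let $(P,\le)$ be a finite connected poset and let $\pi\in\Pi_P$ be a maximal chain (path) of $P$. The extreme rays of the cone $\mathcal{C}(\pi)$ are precisely the geometric embeddings of the antichains which intersect $\pi$ exactly once. That is, a nonzero vector $\omega\in\mathbb{R}_+^P$ spans an extreme ray of $\mathcal{C}(\pi)$ if and only if $\omega$ is a positive multiple of the vector $a(\mathbf{v})=\mathbf{1}\{\mathbf{v}\in A\}$ for some antichain $A\subset P$ that contains exactly one element of $\pi$.
   Context: $P$ is connected means that its Hasse diagram is connected as a graph. $\Pi_P$ denotes the set of maximal chains of $P$, called paths. A path $\pi$ is identified with its indicator vector $\pi(\mathbf{v})=\mathbf{1}\{\mathbf{v}\in\pi\}$ in $\mathbb{R}^P$, and $\langle\cdot,\cdot\rangle$ is the standard inner product on $\mathbb{R}^P$. With $\mathbb{R}_+=[0,\infty)$, for $\pi\in\Pi_P$, $$\mathcal{C}(\pi)=\{\omega\in\mathbb{R}_+^P:\langle\omega,\pi\rangle\ge\langle\omega,\pi'\rangle\text{ for all }\pi'\in\Pi_P\},$$ which is a polyhedral cone. An antichain of $P$ is a subset of $P$ whose elements are pairwise incomparable; an antichain $A$ is embedded in $\mathbb{R}_+^P$ as the vector $a(\mathbf{v})=\mathbf{1}\{\mathbf{v}\in A\}$. A nonzero vector $\omega$ of a polyhedral cone $\mathcal{C}$ is (spans) an extreme ray if whenever $\omega=\alpha\omega_1+\beta\omega_2$ with $\omega_1,\omega_2\in\mathcal{C}$ and $\alpha,\beta>0$, both $\omega_1$ and $\omega_2$ are nonnegative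 multiples of $\omega$. Extreme rays are considered up to positive scaling. *)

(* Defs.v *)
From mathcomp Require Import all_boot all_order all_algebra.
From mathcomp Require Import reals.

Set Implicit Arguments.
Unset Strict Implicit.
Unset Printing Implicit Defensive.

Import Order.TTheory GRing.Theory Num.Theory.

Local Open Scope ring_scope.

Section FinitePosets.
Context {d : Order.disp_t} {P : finPOrderType d}.
Implicit Types (u v : P) (A : {set P}).

Definition covers u v : bool :=
  (u < v)%O && [forall z : P, ~~ ((u < z)%O && (z < v)%O)].

Definition hasse : rel P := [rel u v | covers u v || covers v u].

Definition chain A : bool :=
  [forall u in A, forall v in A, (u >=< v)%O].

Definition antichain A : bool :=
  [forall u in A, forall v in A, (u != v) ==> (u >< v)%O].

Definition maximal_chain A : bool := maxset chain A.

End FinitePosets.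

(* The empty poset counts as connected. *)
Definition connected_poset {d : Order.disp_t} (P : finPOrderType d) : bool :=
  [forall u : P, forall v : P, connect hasse u v].

Section PathCones.
Context {R : realType} {d : Order.disp_t} {P : finPOrderType d}.

(* [R^o] is [R] as a module over itself; it gives {ffun P -> R^o} the scaling
   operation [*:]. *)
Definition indicator (A : {set P}) : {ffun P -> R^o} :=
  [ffun v => (v \in A)%:R].

Definition inner (w w' : {ffun P -> R^o}) : R := \sum_(v : P) w v * w' v.

Definition nonneg_orthant (w : {ffun P -> R^o}) : Prop :=
  forall v : P, 0 <= w v.

Definition path_cone (pi : {set P}) (w : {ffun P -> R^o}) : Prop :=
  nonneg_orthant w /\
  forall pi' : {set P}, maximal_chain pi' ->
    inner w (indicator pi') <= inner w (indicator pi).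

End PathCones.

Definition spans_extreme_ray (R : realType) (V : lmodType R)
    (C : V -> Prop) (w : V) : Prop :=
  [/\ w != 0, C w &
    forall (w1 w2 : V) (a b : R), C w1 -> C w2 -> 0 < a -> 0 < b ->
      w = a *: w1 + b *: w2 ->
      (exists2 c : R, 0 <= c & w1 = c *: w) /\
      (exists2 c : R, 0 <= c & w2 = c *: w)].

(* Main.v *)
Require Import Defs.
From mathcomp Require Import all_boot all_order all_algebra.
From mathcomp Require Import reals.

Set Implicit Arguments.
Unset Strict Implicit.
Unset Printing Implicit Defensive.

(** The cone of a path [pi] consists of the nonnegative weights for which [pi]
    is a heaviest chain: nonnegativity lets maximal chains be replaced by
    arbitrary ones ([chain_weight_le]).

    An antichain [A] meeting [pi] once gives an extreme ray.  A summand of its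
    indicator vanishes off [A], and comparing [pi] with a chain made of a single
    [v] in [A] shows that the summand at [v] is at most its value at the point
    of [A] on [pi].  The two summands add up to the same value at both points,
    so neither inequality is strict and both summands are constant on [A]
    ([antichain_extreme]).

    Conversely, let [w] be a nonzero point of the cone and [A] the antichain of
    minimal elements of its support.  A chain avoiding [A] leaves room below its
    support for one more element of [A], so it is lighter than [pi] by at least
    the weight of that element ([avoiding_chain_light]).  Hence [pi] meets [A],
    and when [e] is the least value of [w] on [A], subtracting [e] times the
    indicator of [A] lowers [pi] by exactly [e] and keeps it heaviest: chains
    meeting [A] are lowered by [e] too, the others were already lighter by [e].
    So the indicator of [A] splits off from [w] within the cone
    ([peel_support_bottom]), and extremality makes [w] a multiple of it. *)

Import Order.TTheory GRing.Theory Num.Theory.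
Local Open Scope ring_scope.

(** * Chains, antichains and minimal elements *)

Section ChainsAntichains.
Context {d : Order.disp_t} {P : finPOrderType d}.
Implicit Types (u v : P) (A B c : {set P}).

Lemma chainP c :
  reflect {in c &, forall u v, (u >=< v)%O} (chain c).
Proof.
apply: (iffP forall_inP) => [cc u v uc vc|cc u uc].
  by move/forall_inP: (cc u uc); apply.
by apply/forall_inP => v; apply: cc.
Qed.

Lemma antichainP A :
  reflect {in A &, forall u v, u != v -> (u >< v)%O} (antichain A).
Proof.
apply: (iffP forall_inP) => [AA u v uA vA|AA u uA].
  by move/forall_inP: (AA u uA) => /(_ v vA)/implyP.
by apply/forall_inP => v vA; apply/implyP; apply: AA.
Qed.

Lemma chain_set1 v : chain [set v].
Proof. by apply/chainP => x y /set1P-> /set1P->; apply: comparablexx. Qed.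

Lemma chain_setU1 u c :
  chain c -> {in c, forall x, (u < x)%O} -> chain (u |: c).
Proof.
move=> /chainP cc uc; apply/chainP => x y /setU1P[->|xc] /setU1P[->|yc].
- exact: comparablexx.
- exact/lt_comparable/uc.
- exact/gt_comparable/uc.
- exact: cc.
Qed.

Lemma chainS B c : B \subset c -> chain c -> chain B.
Proof.
by move=> /subsetP Bc /chainP cc; apply/chainP => x y /Bc xc /Bc; apply: cc.
Qed.

Lemma antichain_chain_card A c :
  antichain A -> chain c -> (#|A :&: c| <= 1)%N.
Proof.
move=> /antichainP AA /chainP cc; apply/card_le1_eqP => u v.
move=> /setIP[uA uc] /setIP[vA vc].
by apply/eqP; apply: contraT => /(AA _ _ vA uA)/negP[]; apply: cc.
Qed.

Definition minimals B : {set P} :=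
  [set u in B | [forall z in B, ~~ (z < u)%O]].

Lemma minimals_antichain B : antichain (minimals B).
Proof.
apply/antichainP => u v /setIdP[uB /forall_inP minu] /setIdP[vB /forall_inP minv].
rewrite /Order.comparable !le_eqVlt eq_sym => /negPf->.
by rewrite (negPf (minu v vB)) (negPf (minv u uB)).
Qed.

Lemma minimals_below B v : v \in B -> exists2 u, u \in minimals B & (u <= v)%O.
Proof.
move=> vB; pose below x := (x \in B) && (x <= v)%O.
have belowv : below v by rewrite /below vB lexx.
(* An element of [B] below [v] with as few predecessors as possible. *)
case: (arg_minnP (fun x => #|[set y | (y <= x)%O]|) belowv).
move=> u /andP[uB uv] umin; exists u => //.
rewrite inE uB; apply/forall_inP => z zB; apply/negP => zu.
have /umin : below z by rewrite /below zB (le_trans (ltW zu) uv).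
rewrite leqNgt => /negP[]; apply: proper_card; apply/properP; split.
  by apply/subsetP => y; rewrite !inE => /le_trans; apply; apply: ltW.
by exists u; rewrite !inE ?lexx// lt_geF.
Qed.

(** The least element of a chain, if any, has a minimal element of [B] strictly
    below it, since it is itself in [B] but not minimal there. *)
Lemma minimals_below_chain B c :
    chain c -> c \subset B -> B != set0 -> [disjoint minimals B & c] ->
  exists2 u, u \in minimals B & {in c, forall x, (u < x)%O}.
Proof.
move=> /chainP cc /subsetP cB /set0Pn[b bB] /disjointFl Ac.
have [->|[x xc]] := set_0Vmem c.
  by have [u uA _] := minimals_below bB; exists u => // y; rewrite inE.
have [m /setIdP[mc /forall_inP minm] _] := minimals_below xc.
have [u uA um] := minimals_below (cB m mc); exists u => // y yc.
have um' : (u < m)%O.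
  by rewrite lt_neqAle um andbT; apply: contraFneq (Ac m mc) => <-.
apply: lt_le_trans um' _.
by have := minm y yc; case: (comparable_ltgtP (cc m y mc yc)).
Qed.

End ChainsAntichains.

(** * Heaviest chains and the path cone *)

Section Weights.
Context {R : realType} {d : Order.disp_t} {P : finPOrderType d}.
Implicit Types (w : {ffun P -> R^o}) (u v : P) (A B c pi : {set P}).

Lemma inner_indicator w c : inner w (indicator c) = \sum_(v in c) w v.
Proof.
rewrite /inner [RHS]big_mkcond; apply: eq_bigr => v _.
by rewrite ffunE; case: (v \in c); rewrite ?mulr1 ?mulr0.
Qed.

(** A nonnegative weight can only grow when a chain is extended to a maximal
    one, so a heaviest path is a heaviest chain. *)
Lemma chain_weight_le pi w c :
  path_cone pi w -> chain c -> \sum_(v in c) w v <= \sum_(v in pi) w v.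
Proof.
move=> [w0 wmax] /maxset_exists[c' c'max cc'].
have := wmax _ c'max; rewrite !inner_indicator; apply: le_trans.
by rewrite [leRHS](big_setID c) /= (setIidPr cc') lerDl sumr_ge0.
Qed.

Lemma path_cone_chains pi w : nonneg_orthant w ->
    (forall c, chain c -> \sum_(v in c) w v <= \sum_(v in pi) w v) ->
  path_cone pi w.
Proof.
move=> w0 wmax; split=> // c /maxsetP[cc _].
by rewrite !inner_indicator wmax.
Qed.

Lemma weight_indicator A c :
  \sum_(v in c) (indicator A : {ffun P -> R^o}) v = #|A :&: c|%:R.
Proof.
rewrite -sum1_card natr_sum big_mkcond [RHS]big_mkcond /=.
by apply: eq_bigr => v _; rewrite ffunE inE; case: (v \in A); case: (v \in c).
Qed.

Lemma indicator_path_cone pi A :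
  antichain A -> #|A :&: pi| = 1%N -> path_cone pi (indicator A : {ffun P -> R^o}).
Proof.
move=> AA Api; apply: path_cone_chains => [v|c cc]; first by rewrite ffunE ler0n.
by rewrite !weight_indicator Api ler_nat antichain_chain_card.
Qed.

Lemma path_coneZ pi (a : R) w :
  0 <= a -> path_cone pi w -> path_cone pi (a *: w).
Proof.
move=> a0 wC; apply: path_cone_chains => [v|c cc].
  by rewrite ffunE mulr_ge0//; case: wC.
have sumZ B : \sum_(v in B) (a *: w) v = a * \sum_(v in B) w v.
  by rewrite mulr_sumr; apply: eq_bigr => v _; rewrite ffunE.
by rewrite !sumZ ler_wpM2l// chain_weight_le.
Qed.

(** The value of a point of the cone at the only element of a path where it may
    be nonzero is its largest value: that element accounts for the whole weight
    of the path, and singletons are chains. *)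
Lemma path_cone_le_at pi A w p v : path_cone pi w ->
    {in ~: A, forall x, w x = 0} -> A :&: pi = [set p] -> w v <= w p.
Proof.
move=> wC wA Api; have := chain_weight_le wC (chain_set1 v).
rewrite big_set1 => /le_trans; apply; rewrite le_eqVlt; apply/orP; left; apply/eqP.
rewrite (big_setID A) /= setIC Api big_set1 big1 ?addr0// => x.
by case/setDP=> _ xA; rewrite wA// inE.
Qed.

(** Only the first summand is described: the roles of the two are symmetric. *)
Lemma antichain_extreme pi A (c a b : R) w1 w2 :
    #|A :&: pi| = 1%N -> 0 < c -> path_cone pi w1 -> path_cone pi w2 ->
    0 < a -> 0 < b -> c *: indicator A = a *: w1 + b *: w2 ->
  exists2 t : R, 0 <= t & w1 = t *: (c *: indicator A).
Proof.
move=> /eqP/cards1P[p Api] c0 C1 C2 a0 b0 E.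
have Ev v : c * (v \in A)%:R = a * w1 v + b * w2 v.
  by move/ffunP/(_ v): E; rewrite !ffunE.
have [w10 _] := C1; have [w20 _] := C2.
have off v : v \notin A -> w1 v = 0 /\ w2 v = 0.
  move=> /negPf vA; have /eqP := Ev v; rewrite vA mulr0 eq_sym.
  rewrite paddr_eq0 ?mulr_ge0 ?w10 ?w20 ?(ltW a0) ?(ltW b0)//.
  by rewrite !mulf_eq0 (gt_eqF a0) (gt_eqF b0) /= => /andP[/eqP-> /eqP->].
have off1 : {in ~: A, forall x, w1 x = 0} by move=> x /setCP/negP/off[].
have off2 : {in ~: A, forall x, w2 x = 0} by move=> x /setCP/negP/off[].
have pA : p \in A by have /setIP[] : p \in A :&: pi by rewrite Api set11.
have const v : v \in A -> w1 v = w1 p.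
  (* [w1] and [w2] are largest at [p], but [a * w1 + b * w2] is constant on [A],
     so a smaller value of [w1] would force a larger one of [w2]. *)
  move=> vA; apply/eqP; rewrite eq_le (path_cone_le_at _ C1 off1 Api)/=.
  have := Ev v; rewrite vA -[true]pA Ev => eqE.
  rewrite -(ler_pM2l a0) -(lerD2r (b * w2 p)) eqE lerD2l ler_pM2l//.
  exact: path_cone_le_at C2 off2 Api.
exists (w1 p / c); first by rewrite divr_ge0 ?w10 ?ltW.
rewrite scalerA divfK ?gt_eqF//; apply/ffunP => v; rewrite !ffunE.
have [vA|vA] := boolP (v \in A); first by rewrite const// [_ *: _]mulr1.
by rewrite scaler0; case: (off v vA).
Qed.

Definition support_bottom w : {set P} := minimals [set v | 0 < w v].

Lemma support_bottom_gt0 w v : v \in support_bottom w -> 0 < w v.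
Proof. by case/setIdP; rewrite inE. Qed.

Lemma support_neq0 w :
  nonneg_orthant w -> w != 0 -> [set v | 0 < w v] != set0.
Proof.
move=> w0; apply: contraNneq => supp0; apply/eqP/ffunP => v; rewrite ffunE.
apply/eqP; move/setP/(_ v): supp0; rewrite !inE lt_neqAle w0 andbT eq_sym.
by move/negbFE.
Qed.

(** The part of the chain where [w] is positive remains a chain after adding a
    suitable element of the bottom antichain below it, and that longer chain is
    no heavier than [pi]. *)
Lemma avoiding_chain_light pi w c : w != 0 -> path_cone pi w -> chain c ->
    [disjoint support_bottom w & c] ->
  exists2 u, u \in support_bottom w &
    \sum_(v in c) w v + w u <= \sum_(v in pi) w v.
Proof.
move=> wn0 wC cc Ac; have [w0 _] := wC.
pose S := [set v | 0 < w v]; pose T := c :&: S.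
have cT : chain T by apply: chainS cc; apply: subsetIl.
have AT : [disjoint minimals S & T] by apply: disjointWr Ac; apply: subsetIl.
have [u uA uT] := minimals_below_chain cT (subsetIr _ _) (support_neq0 w0 wn0) AT.
exists u => //; have := chain_weight_le wC (chain_setU1 cT uT).
rewrite big_setU1 /=; last by apply/negP => /uT; rewrite ltxx.
rewrite addrC; apply: le_trans; rewrite lerD2r (big_setID S) /=.
rewrite [X in _ + X]big1 ?addr0// => v /setDP[_].
by rewrite inE lt_neqAle w0 andbT negbK => /eqP.
Qed.

(** A path avoiding the bottom antichain would be lighter than itself. *)
Lemma support_bottom_meets_path pi w : chain pi -> w != 0 -> path_cone pi w ->
  #|support_bottom w :&: pi| = 1%N.
Proof.
move=> cpi wn0 wC; apply/eqP; rewrite eqn_leq.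
rewrite antichain_chain_card ?minimals_antichain//= card_gt0 setI_eq0.
apply/negP => /(avoiding_chain_light wn0 wC cpi)[u /support_bottom_gt0 u0].
by rewrite gerDl leNgt u0.
Qed.

(** Taking for [e] the least value of [w] on the antichain serves twice: the
    difference stays nonnegative, and [e] is at most the weight by which a chain
    avoiding the antichain falls short of [pi]. *)
Lemma peel_support_bottom pi w : chain pi -> w != 0 -> path_cone pi w ->
  exists2 e : R, 0 < e & path_cone pi (w - e *: indicator (support_bottom w)).
Proof.
move=> cpi wn0 wC; set A := support_bottom w; have [w0 _] := wC.
have Api := support_bottom_meets_path cpi wn0 wC.
have /card_gt0P[p /setIP[pA _]] : (0 < #|A :&: pi|)%N by rewrite Api.
case: (arg_minP w pA) => q qA wq; exists (w q); first exact: support_bottom_gt0.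
have peel c : \sum_(v in c) (w - w q *: indicator A) v
              = \sum_(v in c) w v - w q * #|A :&: c|%:R.
  rewrite -weight_indicator mulr_sumr -sumrB.
  by apply: eq_bigr => v _; rewrite !ffunE.
apply: path_cone_chains => [v|c cc].
  rewrite !ffunE; have [vA|_] := boolP (v \in A).
    by rewrite [_ *: _]mulr1 subr_ge0 wq.
  by rewrite scaler0 subr0.
rewrite !peel Api mulr1.
have [Ac0|Ac_gt0] := posnP #|A :&: c|.
  have /(avoiding_chain_light wn0 wC cc)[u uA] : [disjoint A & c].
    by rewrite -setI_eq0 -cards_eq0 Ac0.
  rewrite Ac0 mulr0 subr0 lerBrDr; apply: le_trans.
  by rewrite lerD2l wq.
have -> : #|A :&: c| = 1%N.
  apply/eqP; rewrite eqn_leq Ac_gt0 andbT.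
  by rewrite antichain_chain_card// minimals_antichain.
by rewrite mulr1 lerD2r chain_weight_le.
Qed.

End Weights.

Theorem theorem1p5 (R : realType) (d : Order.disp_t) (P : finPOrderType d)
    (P_connected : connected_poset P)
    (pi : {set P}) (pi_path : maximal_chain pi)
    (w : {ffun P -> R^o}) (w_neq0 : w != 0) (w_ge0 : nonneg_orthant w) :
  spans_extreme_ray (path_cone pi) w <->
  exists A : {set P},
    [/\ antichain A, #|A :&: pi| = 1%N &
      exists2 c : R, 0 < c & w = c *: indicator A].
Proof.
have [cpi _] := maxsetP pi_path; split=> [[_ wC extr]|].
  pose A := support_bottom w.
  have AA : antichain A by apply: minimals_antichain.
  have Api := support_bottom_meets_path cpi w_neq0 wC.
  have [e e0 peelC] := peel_support_bottom cpi w_neq0 wC.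
  have E : w = 1 *: (w - e *: indicator A) + e *: indicator A.
    by rewrite scale1r subrK.
  have [_ [t t0 At]] :=
    extr _ _ _ _ peelC (indicator_path_cone AA Api) ltr01 e0 E.
  have tn0 : t != 0.
    apply/eqP => t_eq0.
    have /card_gt0P[p /setIP[pA _]] : (0 < #|A :&: pi|)%N by rewrite Api.
    move/ffunP/(_ p): At; rewrite t_eq0 scale0r !ffunE pA => /eqP.
    by rewrite oner_eq0.
  exists A; split=> //; exists t^-1; first by rewrite invr_gt0 lt_neqAle eq_sym tn0.
  by rewrite At scalerA mulVf// scale1r.
case=> A [AA Api [c c0 wE]]; subst w; split=> //.
  exact/path_coneZ/indicator_path_cone/Api/AA/ltW.
move=> w1 w2 a b C1 C2 a0 b0 E; split.
  exact: antichain_extreme Api c0 C1 C2 a0 b0 E.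
by rewrite addrC in E; apply: antichain_extreme Api c0 C2 C1 b0 a0 E.
Qed.
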